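(* Let $S$ be an inverse semigroup. The functors $\Phi'\colon \mathsf{ConRepr}(S)\to \mathsf{TF}(L(S))$ (the restriction of $\Phi$ to connected non-strict $S$-sets) and $\Psi\colon \mathsf{TF}(L(S))\to \mathsf{ConRepr}(S)$ constitute an equivalence of categories between the category $\mathsf{ConRepr}(S)$ of connected non-strict $S$-sets and the category $\mathsf{TF}(L(S))$ of torsion-free functors $L(S)\to\mathsf{Sets}$.
   Context: $S$ is an inverse semigroup, $E(S)$ its semilattice of idempotents, $\mathbf{d}(s)=s^{-1}s$, $\mathbf{r}(s)=ss^{-1}$, and $s\le t$ means $s=te$ for some $e\in E(S)$. $\mathcal{I}(X)$ is the symmetric inverse semigroup of all partial bijections of a set $X$. Loganathan's category $L(S)$: objects are the elements of $E(S)$; arrows are pairs $(f,s)$ with $f\in E(S)$, $s\in S$, $\mathbf{r}(s)\le f$, regarded as an arrow from $\mathbf{d}(s)$ to $f$; composition is $(f,s)(\mathbf{d}(s),t)=(f,st)$. The poset $E(S)$ maps to $L(S)$ by sending $e\le f$ to $(f,e)\colon e\to f$. Non-strict $S$-sets: a non-strict $S$-set $(X,\mu)$ is a set $X$ with a prehomomorphism $\mu\colon S\to\mathcal{I}(X)$, i.e. $\mu(ab)\le\mu(a)\mu(b)$ for all $a,b\in S$; write $s\cdot x=\mu(s)(x)$ where defined. Non-strict $S$-sets are always assumed effective: for every $x\in X$ there is $s\in S$ with $s\cdot x$ defined. A morphism $(X,\mu)\to(Y,\nu)$ is a map $f\colon X\to Y$ such that whenever $s\cdot x$ is defined, the action of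 $s$ on $f(x)$ is defined and equals $f(s\cdot x)$. A non-strict $S$-set is connected if for any $x\in X$ and $e,f\in E(S)$ with $e\cdot x$, $f\cdot x$ defined there is a sequence $e=e_1,\dots,e_k=f$ in $E(S)$ with each $e_i\cdot x$ defined and, for each $i<k$, $e_i\ge e_{i+1}$ or $e_i\le e_{i+1}$. $\mathsf{ConRepr}(S)$ is the full subcategory of connected ones in the category $\mathsf{Repr}(S)$ of all non-strict $S$-sets. Torsion-free functors: for a functor $F\colon L(S)\to\mathsf{Sets}$ let $\Psi(F)=\left(\bigcup_{e\in E(S)}\{e\}\times F(e)\right)/\sim$, where $\sim$ is the equivalence relation generated by $(e,x)\sim(e',F(e',e)(x))$ for $e\le e'$, $x\in F(e)$ (the colimit of $E(S)\to L(S)\to\mathsf{Sets}$); $[e,x]$ denotes the class of $(e,x)$. $F$ is torsion-free if $(e,x)\sim(e,y)$ implies $x=y$. $\mathsf{TF}(L(S))$ has torsion-free functors as objects and natural transformations as morphisms. The functor $\Phi\colon \mathsf{Repr}(S)\to\mathsf{TF}(L(S))$: $\Phi(X,\mu)(e)=\{x\in X: e\cdot x \text{ is defined}\}$; $\Phi(X,\mu)(f,s)$ is the map $x\mapsto s\cdot x$ from $\Phi(X,\mu)(\mathbf{d}(s))$ to $\Phi(X,\mu)(f)$; on a morphism $g$, $\Phi(g)$ has components the restrictions of $g$. The functor $\Psi$: for $F$ torsion-free, $\Psi(F)$ carries the action where $s\circ\alpha$ is defined iff $\alpha=[\mathbf{d}(s),x]$ for some $x\in F(\mathbf{d}(s))$,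 and then $s\circ\alpha=[\mathbf{r}(s),F(\mathbf{r}(s),s)(x)]$. For a natural transformation $\alpha\colon F\to F'$, $\Psi(\alpha)$ is $[e,x]\mapsto[e,\alpha(e)(x)]$. *)

(* Defs.v *)
From HB Require Import structures.
From mathcomp Require Import all_boot generic_quotient.
From mathcomp Require Import boolp.
From Stdlib Require Import Relation_Operators Operators_Properties.

Set Implicit Arguments.
Unset Strict Implicit.
Unset Printing Implicit Defensive.

Record category := Category {
  ob :> Type;
  hom : ob -> ob -> Type;
  idc : forall a, hom a a;
  (* [compc g f] is "g after f" *)
  compc : forall a b c, hom b c -> hom a b -> hom a c;
  compc1 : forall a b (f : hom a b), compc f (idc a) = f;
  comp1c : forall a b (f : hom a b), compc (idc b) f = f;
  compcA : forall a b c d (h : hom c d) (g : hom b c) (f : hom a b),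
    compc h (compc g f) = compc (compc h g) f
}.
Arguments hom {_} _ _.
Arguments idc {_} _.
Arguments compc {_ _ _ _} _ _.

Record functor (C D : category) := Functor {
  fob :> C -> D;
  fmap : forall a b, hom a b -> hom (fob a) (fob b);
  fmap1 : forall a, fmap (idc a) = idc (fob a);
  fmapM : forall a b c (g : hom b c) (f : hom a b),
    fmap (compc g f) = compc (fmap g) (fmap f)
}.
Arguments fmap {_ _} _ {_ _} _.

Record nattrans (C D : category) (F G : functor C D) := NatTrans {
  component :> forall a, hom (F a) (G a);
  naturality : forall a b (f : hom a b),
    compc (component b) (fmap F f) = compc (fmap G f) (component a)
}.

Lemma nattrans_eq (C D : category) (F G : functor C D) (u v : nattrans F G) :
  (forall a, u a = v a) -> u = v.
Proof.
case: u v => [u hu] [v hv] /= uv.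
have E : u = v by apply: functional_extensionality_dep.
by subst v; congr NatTrans; apply: Prop_irrelevance.
Qed.

Definition idfunctor (C : category) : functor C C.
Proof. by exists id (fun a b => id). Defined.

Definition compfunctor (C D K : category) (G : functor D K) (F : functor C D) :
  functor C K.
Proof.
exists (fun a => G (F a)) (fun a b f => fmap G (fmap F f)) => [a|a b c g f].
- by rewrite !fmap1.
- by rewrite !fmapM.
Defined.

Definition idnat (C D : category) (F : functor C D) : nattrans F F.
Proof.
by exists (fun a => idc (F a)) => a b f; rewrite comp1c compc1.
Defined.

Definition compnat (C D : category) (F G H : functor C D)
  (v : nattrans G H) (u : nattrans F G) : nattrans F H.
Proof.
exists (fun a => compc (v a) (u a)) => a b f.
by rewrite -compcA naturality !compcA naturality.
Defined.

Definition functor_cat (C D : category) : category.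
Proof.
exists (functor C D) (@nattrans C D) (@idnat C D) (@compnat C D).
- by move=> F G u; apply: nattrans_eq => a; rewrite /= compc1.
- by move=> F G u; apply: nattrans_eq => a; rewrite /= comp1c.
- by move=> F G H K w v u; apply: nattrans_eq => a; rewrite /= compcA.
Defined.

Definition Sets : category.
Proof. by exists Type (fun X Y => X -> Y) (fun X => id) (fun _ _ _ g f => g \o f). Defined.

Lemma Sets_fmapM (C : category) (F : functor C Sets) (a b c : C)
  (g : hom b c) (f : hom a b) (x : F a) :
  fmap F g (fmap F f x) = fmap F (compc g f) x.
Proof. by rewrite fmapM. Qed.

Lemma Sets_naturality (C : category) (F G : functor C Sets) (u : nattrans F G)
  (a b : C) (f : hom a b) (x : F a) : u b (fmap F f x) = fmap G f (u a x).
Proof. exact: (congr1 (fun h => h x) (naturality u f)). Qed.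

Definition full_subcat (C : category) (P : C -> Prop) : category.
Proof.
exists {a : C | P a} (fun a b => hom (sval a) (sval b))
  (fun a => idc (sval a)) (fun a b c g f => compc g f).
- by move=> a b f; rewrite compc1.
- by move=> a b f; rewrite comp1c.
- by move=> a b c d h g f; rewrite compcA.
Defined.

Definition full_incl (C : category) (P : C -> Prop) : functor (full_subcat P) C.
Proof. by exists (fun a => sval a) (fun a b f => f). Defined.

Definition is_iso (C : category) (a b : C) (f : hom a b) : Prop :=
  exists g : hom b a, compc g f = idc a /\ compc f g = idc b.

Definition naturally_isomorphic (C D : category) (F G : functor C D) : Prop :=
  exists u : nattrans F G, forall a, is_iso (u a).

Definition equivalence_of_categories (C D : category)
  (F : functor C D) (G : functor D C) : Prop :=
  naturally_isomorphic (idfunctor C) (compfunctor G F) /\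
  naturally_isomorphic (compfunctor F G) (idfunctor D).

(* [semigroupType] carries a [choiceType]; with the axioms of [boolp] every
   type has one, so this is no restriction on the carrier. *)
HB.mixin Record Semigroup_isInverse S of Semigroup S := {
  invs : S -> S;
  mulsVs : forall s : S, mul (mul s (invs s)) s = s;
  mulVsV : forall s : S, mul (mul (invs s) s) (invs s) = invs s;
  invs_uniq : forall s t : S,
    mul (mul s t) s = s -> mul (mul t s) t = t -> t = invs s
}.

#[short(type="invSemigroupType")]
HB.structure Definition InvSemigroup := {S of Semigroup S & Semigroup_isInverse S}.

Declare Scope invsg_scope.
Delimit Scope invsg_scope with I.
Bind Scope invsg_scope with InvSemigroup.sort.
Local Open Scope quotient_scope.
Local Open Scope invsg_scope.
Notation "s * t" := (mul s%I t%I) : invsg_scope.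
Notation "s ^-1" := (invs s) : invsg_scope.

Section InvSemigroup.
Variable S : invSemigroupType.
Implicit Types s t : S.

Record idem := Idem { idem_val :> S; idemP : idem_val * idem_val == idem_val }.
HB.instance Definition _ := [isSub for idem_val].
HB.instance Definition _ := [Choice of idem by <:].
Implicit Types e f g : idem.

Definition nle s t : Prop := exists e, s = t * (e : S).

Lemma idemE e : (e : S) * (e : S) = e :> S. Proof. exact/eqP/idemP. Qed.

Lemma invs_idem s : s * s = s -> s^-1 = s.
Proof. by move=> ss; apply/esym/invs_uniq; rewrite !ss. Qed.

Lemma invsK s : s^-1^-1 = s.
Proof. by apply/esym/invs_uniq; rewrite ?mulsVs ?mulVsV. Qed.

Lemma idemM s t : s * s = s -> t * t = t -> (s * t) * (s * t) = s * t.
Proof.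
move=> ss tt; set x := (s * t)^-1.
have xE : x = t * x * s.
  apply/esym/invs_uniq.
    have -> : s * t * (t * x * s) * (s * t) = s * (t * t) * x * (s * s) * t.
      by rewrite !mulgA.
    by rewrite tt ss -(mulgA _ s t) mulsVs.
  have -> : t * x * s * (s * t) * (t * x * s) = t * x * (s * s) * (t * t) * x * s.
    by rewrite !mulgA.
  rewrite tt ss.
  have -> : t * x * s * t * x * s = t * (x * (s * t) * x) * s by rewrite !mulgA.
  by rewrite mulVsV.
have xx : x * x = x.
  rewrite {1 2}xE.
  have -> : t * x * s * (t * x * s) = t * (x * (s * t) * x) * s by rewrite !mulgA.
  by rewrite mulVsV -xE.
have := invs_idem xx; rewrite /x invsK => E.
by rewrite -/x in E; rewrite {1 2}E xx E.
Qed.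

Lemma idemC s t : s * s = s -> t * t = t -> s * t = t * s.
Proof.
move=> ss tt; have st := idemM ss tt; have ts := idemM tt ss.
rewrite -(invs_idem st); apply/esym/invs_uniq.
- have -> : s * t * (t * s) * (s * t) = s * (t * t) * (s * s) * t by rewrite !mulgA.
  by rewrite tt ss -(mulgA _ s t) st.
- have -> : t * s * (s * t) * (t * s) = t * (s * s) * (t * t) * s by rewrite !mulgA.
  by rewrite tt ss -(mulgA _ t s) ts.
Qed.

Lemma idemCE e f : (e : S) * (f : S) = (f : S) * (e : S).
Proof. by apply: idemC; apply: idemE. Qed.

Lemma dom_subproof s : (s^-1 * s) * (s^-1 * s) == s^-1 * s.
Proof. by rewrite mulgA mulVsV. Qed.
Definition dom s : idem := Idem (dom_subproof s).

Lemma ran_subproof s : (s * s^-1) * (s * s^-1) == s * s^-1.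
Proof. by rewrite mulgA mulsVs. Qed.
Definition ran s : idem := Idem (ran_subproof s).

Lemma muls_dom s : s * (dom s : S) = s.
Proof. by rewrite /= mulgA mulsVs. Qed.

Lemma ran_muls s : (ran s : S) * s = s.
Proof. exact: mulsVs. Qed.

Lemma invsM s t : (s * t)^-1 = t^-1 * s^-1.
Proof.
apply/esym/invs_uniq.
- have -> : s * t * (t^-1 * s^-1) * (s * t) = s * ((ran t : S) * (dom s : S)) * t.
    by rewrite /= !mulgA.
  rewrite idemCE.
  have -> : s * ((dom s : S) * (ran t : S)) * t = (s * (dom s : S)) * ((ran t : S) * t) by rewrite !mulgA.
  by rewrite muls_dom ran_muls.
- have -> : t^-1 * s^-1 * (s * t) * (t^-1 * s^-1) = t^-1 * ((dom s : S) * (ran t : S)) * s^-1.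
    by rewrite /= !mulgA.
  rewrite idemCE.
  have -> : t^-1 * ((ran t : S) * (dom s : S)) * s^-1
            = (t^-1 * t * t^-1) * (s^-1 * s * s^-1) by rewrite /= !mulgA.
  by rewrite !mulVsV.
Qed.

Lemma dom_idem e : dom e = e.
Proof. by apply: val_inj; rewrite /= invs_idem idemE. Qed.

Lemma ran_idem e : ran e = e.
Proof. by apply: val_inj; rewrite /= invs_idem idemE. Qed.

Lemma nle_idemE e f : nle e f <-> e = (f : S) * (e : S) :> S.
Proof.
split=> [[g ->]|E]; last by exists e.
by rewrite mulgA idemE.
Qed.

Lemma nle_refl e : nle e e.
Proof. by apply/nle_idemE; rewrite idemE. Qed.

Lemma nle_trans f e g : nle e f -> nle f g -> nle e g.
Proof.
move=> /nle_idemE ef /nle_idemE fg; apply/nle_idemE.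
by rewrite ef mulgA -fg.
Qed.

Lemma nle_ran_mul e t : nle (ran t) e -> (e : S) * t = t.
Proof.
by move=> /nle_idemE E; rewrite -{1}(ran_muls t) mulgA -E ran_muls.
Qed.

Lemma dom_comp s t : nle (ran t) (dom s) -> dom (s * t) = dom t.
Proof.
move=> /nle_ran_mul E; apply: val_inj; rewrite /= invsM.
have -> : t^-1 * s^-1 * (s * t) = t^-1 * ((dom s : S) * t) by rewrite /= !mulgA.
by rewrite E.
Qed.

Lemma ran_comp s t : nle (ran (s * t)) (ran s).
Proof. by apply/nle_idemE; rewrite /= invsM !mulgA mulsVs. Qed.

(* The arrow (f, s), from [dom s] to f; the source and target are indices. *)
Record Lhom e f := LHom {
  Larr :> S;
  Ldom : dom Larr = e;
  Lran : nle (ran Larr) f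
}.

Lemma Lhom_eq e f (u v : Lhom e f) : u = v :> S -> u = v.
Proof.
case: u v => [u du ru] [v dv rv] /= uv; subst v.
by congr LHom; apply: Prop_irrelevance.
Qed.

Lemma Lincl_subproof e f : nle e f -> nle (ran e) f.
Proof. by rewrite ran_idem. Qed.
Definition Lincl e f (h : nle e f) : Lhom e f :=
  LHom (dom_idem e) (Lincl_subproof h).

Definition Lid e : Lhom e e := Lincl (nle_refl e).

Lemma Lcomp_dom e f g (u : Lhom f g) (v : Lhom e f) : dom ((u : S) * (v : S)) = e.
Proof.
by rewrite dom_comp ?Ldom //; apply: Lran.
Qed.
Lemma Lcomp_ran e f g (u : Lhom f g) (v : Lhom e f) : nle (ran ((u : S) * (v : S))) g.
Proof. by apply: nle_trans (Lran u); apply: ran_comp. Qed.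
Definition Lcomp e f g (u : Lhom f g) (v : Lhom e f) : Lhom e g :=
  LHom (Lcomp_dom u v) (Lcomp_ran u v).

Definition Lcat : category.
Proof.
exists idem Lhom Lid Lcomp.
- by move=> e f u; apply: Lhom_eq; rewrite /= -{2}(muls_dom u) Ldom.
- move=> e f u; apply: Lhom_eq => /=; exact: nle_ran_mul (Lran u).
- by move=> e f g h w v u; apply: Lhom_eq; rewrite /= mulgA.
Defined.

End InvSemigroup.

Notation "s <= t" := (nle s t) : invsg_scope.

(* A partial bijection of X: [f x = None] when f is undefined at x. *)
Record pbij (X : Type) := PBij {
  pbij_fun :> X -> option X;
  pbij_inj : forall x y z,
    pbij_fun x = Some z -> pbij_fun y = Some z -> x = y
}.

HB.instance Definition _ (X : Type) := gen_eqMixin (pbij X).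
HB.instance Definition _ (X : Type) := gen_choiceMixin (pbij X).

Section SymmetricInverseSemigroup.
Variable X : Type.
Implicit Types f g : pbij X.

Lemma pbij_eq f g : f =1 g -> f = g.
Proof.
case: f g => [f hf] [g hg] /= /funext fg; subst g.
by congr PBij; apply: Prop_irrelevance.
Qed.

Lemma pbij_ext f g : (forall x y, f x = Some y <-> g x = Some y) -> f = g.
Proof.
move=> fg; apply: pbij_eq => x.
case fx: (f x) => [y|]; first by have [/(_ fx)] := fg x y.
by case gx: (g x) => [y|] //; have [_ /(_ gx)] := fg x y; rewrite fx.
Qed.

(* [pbij_mul f g] applies g first. *)
Definition pbij_mul f g : pbij X.
Proof.
exists (fun x => obind f (g x)) => x y z.
case gx: (g x) => [x'|] //= fx'; case gy: (g y) => [y'|] //= fy'.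
by apply: (pbij_inj gx); rewrite gy (pbij_inj fx' fy').
Defined.

Definition pbij_inv f : pbij X.
Proof.
exists (fun y => if pselect (exists x, f x = Some y) is left h
                 then Some (projT1 (cid h)) else None) => x y z.
case: pselect => // h [<-]; case: pselect => // k [].
by case: (cid h) (cid k) => a fa [b fb] /= ab; move: fa fb; rewrite ab => -> [].
Defined.

Lemma pbij_mulP f g x z :
  pbij_mul f g x = Some z <-> exists2 y, g x = Some y & f y = Some z.
Proof.
rewrite /=; case: (g x) => [y|] /=; last by split=> // -[].
by split=> [fy|[_ [<-] //]]; exists y.
Qed.

Lemma pbij_invP f x y : pbij_inv f y = Some x <-> f x = Some y.
Proof.
rewrite /=; case: pselect => [h|h]; last by split=> // fx; case: h; exists x.
case: (cid h) => a fa /=; split=> [[<-] //|fx].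
by rewrite (pbij_inj fa fx).
Qed.

Lemma pbij_mulA : associative pbij_mul.
Proof. by move=> f g h; apply: pbij_eq => x /=; case: (h x). Qed.

HB.instance Definition _ := isSemigroup.Build (pbij X) pbij_mulA.

Lemma pbij_mulsVs f : pbij_mul (pbij_mul f (pbij_inv f)) f = f.
Proof.
apply: pbij_ext => x y; split=> [/pbij_mulP[z fx /pbij_mulP[w]]|fx].
  by move=> /pbij_invP fw; rewrite fw => <-.
apply/pbij_mulP; exists y => //; apply/pbij_mulP; exists x => //.
exact/pbij_invP.
Qed.

Lemma pbij_mulVsV f : pbij_mul (pbij_mul (pbij_inv f) f) (pbij_inv f) = pbij_inv f.
Proof.
apply: pbij_ext => y x; split=> [/pbij_mulP[z fz /pbij_mulP[w fw]]|fx].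
  by move/pbij_invP: (fz); rewrite fw => -[->].
apply/pbij_mulP; exists x => //; apply/pbij_mulP; exists y => //.
exact/pbij_invP.
Qed.

Lemma pbij_inv_uniq f g : pbij_mul (pbij_mul f g) f = f ->
  pbij_mul (pbij_mul g f) g = g -> g = pbij_inv f.
Proof.
move=> fgf gfg; apply: pbij_ext => y x; rewrite pbij_invP; split=> [gy|fx].
  move: (gy); rewrite -{1}gfg => /pbij_mulP[x']; rewrite gy => -[<-].
  by move=> /pbij_mulP[z fx gz]; rewrite (pbij_inj gy gz).
move: (fx); rewrite -{1}fgf => /pbij_mulP[y']; rewrite fx => -[<-].
by move=> /pbij_mulP[z gy fz]; rewrite (pbij_inj fx fz).
Qed.

HB.instance Definition _ :=
  Semigroup_isInverse.Build (pbij X) pbij_mulsVs pbij_mulVsV pbij_inv_uniq.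

Lemma pbij_idemP (e : idem (pbij X)) x y : (idem_val e : pbij X) x = Some y -> y = x.
Proof.
move=> ex; have ee := idemE e.
move: (ex); rewrite -{1}ee => /pbij_mulP[z]; rewrite ex => -[<-] ey.
exact: pbij_inj ey ex.
Qed.

Definition pbij_dom f : pbij X.
Proof.
exists (fun x => if f x then Some x else None) => x y z.
by case: (f x) => // a; case: (f y) => // b [->] [].
Defined.

Lemma pbij_leP f g : f <= g <-> forall x y, f x = Some y -> g x = Some y.
Proof.
split=> [[e ->] x y /pbij_mulP[z ex]|fg]; first by rewrite (pbij_idemP ex).
have ee : mul (pbij_dom f) (pbij_dom f) == pbij_dom f.
  apply/eqP; apply: pbij_eq => x.
  by rewrite /mul /=; case E: (f x) => //=; rewrite E.
exists (Idem ee); apply: pbij_eq => x; rewrite /mul /=.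
by case fx: (f x) => [y|] //=; rewrite (fg _ _ fx).
Qed.

End SymmetricInverseSemigroup.

Definition prehomomorphism (S T : invSemigroupType) (m : S -> T) : Prop :=
  forall a b, m (a * b) <= m a * m b.

Record nsset (S : invSemigroupType) := NSSet {
  carrier :> Type;
  act : S -> pbij carrier;
  act_prehom : prehomomorphism act;
  act_effective : forall x, exists s, isSome (act s x)
}.
Arguments act {S} _ _.

Section Repr.
Variable S : invSemigroupType.
Implicit Types X Y Z : nsset S.

Record nsmor X Y := NSMor {
  nsfun :> X -> Y;
  nsmorP : forall s x y, act X s x = Some y -> act Y s (nsfun x) = Some (nsfun y)
}.

Lemma nsmor_eq X Y (f g : nsmor X Y) : f =1 g -> f = g.
Proof.
case: f g => [f hf] [g hg] /= /funext fg; subst g.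
by congr NSMor; apply: Prop_irrelevance.
Qed.

Definition nsid X : nsmor X X.
Proof. by exists id. Defined.

Definition nscomp X Y Z (g : nsmor Y Z) (f : nsmor X Y) : nsmor X Z.
Proof. by exists (g \o f) => s x y sx; do 2!apply: nsmorP. Defined.

Definition Repr : category.
Proof. by exists (nsset S) nsmor nsid nscomp => *; apply: nsmor_eq. Defined.

(* [e :: p] is the sequence e_1, ..., e_k. *)
Definition connected X : Prop :=
  forall (x : X) (e f : idem S), act X e x -> act X f x ->
  exists p : seq (idem S),
    [/\ all (fun g : idem S => act X g x) (e :: p),
        path (fun g h : idem S => `[< h <= g \/ g <= h >]) e p
      & last e p = f].

Definition ConRepr : category := full_subcat (C := Repr) connected.

Lemma act_mul X s t x y : act X (s * t) x = Some y ->
  exists2 z, act X t x = Some z & act X s z = Some y.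
Proof.
by have /pbij_leP h := @act_prehom S X s t; move=> /h /pbij_mulP.
Qed.

Lemma act_idem X (e : idem S) x y : act X e x = Some y -> y = x.
Proof.
move=> ex; have := ex; rewrite -{1}(idemE e) => /act_mul[z].
by rewrite ex => -[<-] ey; apply: (pbij_inj ey ex).
Qed.

Lemma act_idemE X (e : idem S) x : act X e x -> act X e x = Some x.
Proof. by case ex: (act X e x) => [y|] // _; rewrite (act_idem ex). Qed.

Lemma act_dom X s x : act X (dom s) x = act X s x :> bool.
Proof.
apply/idP/idP.
  by case E: (act X (dom s) x) => [y|] // _; have [z ->] := act_mul E.
case E: (act X s x) => [y|] // _; move: E; rewrite -{1}(muls_dom s).
by move=> /act_mul[z ->].
Qed.

Lemma act_ran X s x y : act X s x = Some y -> act X (ran s) y = Some y.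
Proof.
move=> sx; have := sx; rewrite -{1}(ran_muls s) => /act_mul[z].
by rewrite sx => -[<-].
Qed.

Lemma act_nle X (e f : idem S) x : e <= f -> act X e x -> act X f x.
Proof.
move=> /nle_idemE ef /act_idemE ex; have := ex; rewrite {1}ef.
by move=> /act_mul[z]; rewrite ex => -[<-] ->.
Qed.

End Repr.

Section TorsionFree.
Variable S : invSemigroupType.
Implicit Types F G : functor (Lcat S) Sets.

Definition elements F : Type := {e : idem S & F e}.

(* The inclusions e <= e' are the arrows (e', e) of the category. *)
Definition elt_step F (p q : elements F) : Prop :=
  exists h : tag p <= tag q, tagged q = fmap F (Lincl h : hom (tag p : Lcat S) (tag q)) (tagged p).

Definition elt_equiv F : elements F -> elements F -> Prop :=
  clos_refl_sym_trans (elements F) (@elt_step F).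

Definition torsion_free F : Prop :=
  forall (e : idem S) (x y : F e),
    elt_equiv (Tagged (fun e => F e) x) (Tagged (fun e => F e) y) -> x = y.

Definition TF : category :=
  full_subcat (C := functor_cat (Lcat S) Sets) torsion_free.

End TorsionFree.

Definition oval (T : Type) (o : option T) : isSome o -> T :=
  if o is Some x then fun=> x else fun h => False_rect T (notF h).

Lemma ovalK T (o : option T) (h : isSome o) : o = Some (oval h).
Proof. by case: o h. Qed.

Section Phi.
Variable S : invSemigroupType.
Implicit Types X Y : nsset S.

Definition Phi_ob X (e : idem S) : Type := {x : X | act X e x}.

Lemma Phi_arr_def X (e f : idem S) (u : Lhom e f) (x : Phi_ob X e) :
  act X u (sval x).
Proof. by rewrite -act_dom Ldom; case: x. Qed.

Lemma Phi_arr_ran X (e f : idem S) (u : Lhom e f) (x : Phi_ob X e) :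
  act X f (oval (Phi_arr_def u x)).
Proof.
apply: act_nle (Lran u) _.
by rewrite (act_ran (ovalK (Phi_arr_def u x))).
Qed.

Definition Phi_arr X (e f : idem S) (u : Lhom e f) (x : Phi_ob X e) : Phi_ob X f :=
  exist _ (oval (Phi_arr_def u x)) (Phi_arr_ran u x).

Lemma Phi_arrE X (e f : idem S) (u : Lhom e f) (x : Phi_ob X e) :
  act X u (sval x) = Some (sval (Phi_arr u x)).
Proof. exact: ovalK. Qed.

Lemma Phi_ob_eq X (e : idem S) (x y : Phi_ob X e) : sval x = sval y -> x = y.
Proof.
case: x y => [x hx] [y hy] /= xy; subst y.
by congr exist; apply: Prop_irrelevance.
Qed.

Lemma Phi_arr1 X (e : idem S) : Phi_arr (X := X) (Lid e) = id.
Proof.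
apply: funext => x; apply: Phi_ob_eq.
have /= := Phi_arrE (Lid e) x; exact: act_idem.
Qed.

Lemma Phi_arrM X (e f g : idem S) (u : Lhom f g) (v : Lhom e f) :
  Phi_arr (X := X) (Lcomp u v) = Phi_arr u \o Phi_arr v.
Proof.
apply: funext => x; apply: Phi_ob_eq.
have /act_mul[z vx uz] := Phi_arrE (Lcomp u v) x.
move: vx uz; rewrite Phi_arrE => -[<-].
by rewrite (Phi_arrE u (Phi_arr v x)) => -[].
Qed.

Definition Phi_fun X : functor (Lcat S) Sets :=
  @Functor (Lcat S) Sets (Phi_ob X) (@Phi_arr X) (@Phi_arr1 X) (@Phi_arrM X).

Lemma Phi_torsion_free X : torsion_free (Phi_fun X).
Proof.
have H (p q : elements (Phi_fun X)) :
    elt_equiv p q -> sval (tagged p) = sval (tagged q).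
  elim=> {p q} [p q [h ->]|//|//|p q r _ -> _ ->] //.
  by have /= := Phi_arrE (Lincl h) (tagged p); move/act_idem => ->.
by move=> e x y /H /Phi_ob_eq.
Qed.

Lemma Phi_mor_def X Y (g : nsmor X Y) (e : idem S) (x : Phi_ob X e) :
  act Y e (g (sval x)).
Proof. by case: x => x hx /=; rewrite (nsmorP g (act_idemE hx)). Qed.

Definition Phi_mor_comp X Y (g : nsmor X Y) (e : idem S) (x : Phi_ob X e) :
  Phi_ob Y e := exist _ (g (sval x)) (Phi_mor_def g x).

Lemma Phi_mor_nat X Y (g : nsmor X Y) (e f : idem S) (u : Lhom e f) :
  Phi_mor_comp g (e := f) \o Phi_arr u = Phi_arr u \o Phi_mor_comp g (e := e).
Proof.
apply: funext => x; apply: Phi_ob_eq.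
have := nsmorP g (Phi_arrE u x).
by rewrite [LHS](Phi_arrE u (Phi_mor_comp g x)) => -[].
Qed.

Definition Phi_mor X Y (g : nsmor X Y) : nattrans (Phi_fun X) (Phi_fun Y) :=
  @NatTrans _ _ (Phi_fun X) (Phi_fun Y) (@Phi_mor_comp X Y g) (@Phi_mor_nat X Y g).

Definition Phi : functor (Repr S) (TF S).
Proof.
exists (fun X => exist _ (Phi_fun X) (@Phi_torsion_free X)) Phi_mor.
- by move=> X; apply: nattrans_eq => e; apply: funext => x; apply: Phi_ob_eq.
- by move=> X Y Z g f; apply: nattrans_eq => e; apply: funext => x; apply: Phi_ob_eq.
Defined.

Definition Phi' : functor (ConRepr S) (TF S) :=
  compfunctor Phi (full_incl (C := Repr S) (@connected S)).

End Phi.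

Section PsiObject.
Variables (S : invSemigroupType) (F : functor (Lcat S) Sets).

Definition elt_rel : rel {classic elements F} := fun p q => `[< elt_equiv p q >].

Lemma elt_rel_refl : reflexive elt_rel.
Proof. by move=> p; apply/asboolP; apply: rst_refl. Qed.

Lemma elt_rel_sym : symmetric elt_rel.
Proof.
by move=> p q; apply/idP/idP => /asboolP h; apply/asboolP; apply: rst_sym.
Qed.

Lemma elt_rel_trans : transitive elt_rel.
Proof.
move=> q p r /asboolP pq /asboolP qr; apply/asboolP.
exact: rst_trans pq qr.
Qed.

Canonical elt_rel_equiv := EquivRel elt_rel elt_rel_refl elt_rel_sym elt_rel_trans.

Definition Psi_ob : Type := {eq_quot elt_rel}.

(* [e, x] *)
Definition cls (e : idem S) (x : F e) : Psi_ob :=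
  \pi_{eq_quot elt_rel}%qT (Tagged (fun e => F e) x : {classic elements F}).

Lemma clsP (e f : idem S) (x : F e) (y : F f) :
  cls x = cls y <->
  elt_equiv (Tagged (fun e => F e) x) (Tagged (fun e => F e) y).
Proof.
split=> [/eqmodP/asboolP//|xy].
by apply/eqmodP/asboolP.
Qed.

Lemma cls_surj (a : Psi_ob) : exists (e : idem S) (x : F e), a = cls x.
Proof.
exists (tag (repr a : elements F)), (tagged (repr a : elements F)).
by rewrite /cls /Tagged -sigT_eta reprK.
Qed.

Lemma cls_incl (e f : idem S) (h : e <= f) (x : F e) :
  cls (fmap F (Lincl h : hom (e : Lcat S) f) x) = cls x.
Proof. by apply/clsP/rst_sym/rst_step; exists h. Qed.

Lemma cls_arr (e f g : idem S) (u : Lhom e f) (v : Lhom e g) (x : F e) :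
  u = v :> S ->
  cls (fmap F (u : hom (e : Lcat S) f) x) = cls (fmap F (v : hom (e : Lcat S) g) x).
Proof.
move=> uv.
have corestr (k : idem S) (w : Lhom e k) :
    w = u :> S -> cls (fmap F (w : hom (e : Lcat S) k) x)
      = cls (fmap F (LHom (Ldom u) (nle_refl (ran u)) : hom (e : Lcat S) (ran u)) x).
  move=> wu; have h : ran u <= k by rewrite -wu; apply: Lran.
  rewrite -(cls_incl h); congr cls.
  rewrite Sets_fmapM; congr (fmap F _ x).
  by apply: Lhom_eq; rewrite /= wu ran_muls.
by rewrite corestr // [RHS]corestr.
Qed.

(* The arrow (r(s), s). *)
Definition Larrow (s : S) : hom (dom s : Lcat S) (ran s) :=
  LHom (erefl (dom s)) (nle_refl (ran s)).

(* [Psi_funE]: for torsion-free F the value does not depend on the chosen x. *)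
Definition Psi_fun (s : S) (a : Psi_ob) : option Psi_ob :=
  if pselect (exists x : F (dom s), a = cls x) is left h
  then Some (cls (fmap F (Larrow s) (projT1 (cid h)))) else None.

Hypothesis F_tf : torsion_free F.

Lemma Psi_funE s (x : F (dom s)) :
  Psi_fun s (cls x) = Some (cls (fmap F (Larrow s) x)).
Proof.
rewrite /Psi_fun; case: pselect => [h|[]]; last by exists x.
by case: (cid h) => y /= /clsP /F_tf <-.
Qed.

Lemma Psi_funP s a b : Psi_fun s a = Some b ->
  exists2 x : F (dom s), a = cls x & b = cls (fmap F (Larrow s) x).
Proof.
rewrite /Psi_fun; case: pselect => // h [<-].
by exists (projT1 (cid h)) => //; case: (cid h).
Qed.

Lemma fmap_inj s : injective (fmap F (Larrow s)).
Proof.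
have d : dom s^-1 = ran s by apply: val_inj; rewrite /= invsK.
have r : ran s^-1 <= dom s by apply/nle_idemE; rewrite /= invsK [RHS](idemE (dom s)).
pose v : hom (ran s : Lcat S) (dom s) := LHom d r.
apply: (can_inj (g := fmap F v)) => x.
rewrite Sets_fmapM.
have -> : compc v (Larrow s) = idc (dom s : Lcat S) by apply: Lhom_eq.
by rewrite fmap1.
Qed.

Lemma Psi_fun_inj s a b c : Psi_fun s a = Some c -> Psi_fun s b = Some c -> a = b.
Proof.
move=> /Psi_funP[x -> ->] /Psi_funP[y -> /clsP /F_tf xy].
by rewrite (fmap_inj xy).
Qed.

Definition Psi_act (s : S) : pbij Psi_ob := PBij (@Psi_fun_inj s).

Lemma Psi_prehom : prehomomorphism Psi_act.
Proof.
move=> s t; apply/pbij_leP => a b /Psi_funP[x -> ->]; apply/pbij_mulP.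
have h : dom (s * t) <= dom t.
  apply/nle_idemE; rewrite /= invsM.
  have -> : t^-1 * t * (t^-1 * s^-1 * (s * t)) = (t^-1 * t * t^-1) * s^-1 * (s * t).
    by rewrite !mulgA.
  by rewrite mulVsV.
have wE : ((dom s : S) * t)^-1 * ((dom s : S) * t) = dom (s * t) :> S.
  rewrite invsM (invs_idem (idemE (dom s))).
  have -> : t^-1 * (dom s : S) * ((dom s : S) * t)
            = t^-1 * ((dom s : S) * (dom s : S)) * t by rewrite !mulgA.
  by rewrite idemE /= invsM !mulgA.
have d : dom ((dom s : S) * t) = dom (s * t) by apply: val_inj.
have r : ran ((dom s : S) * t) <= dom s by rewrite -{2}(ran_idem (dom s)); apply: ran_comp.
pose w : hom (dom (s * t) : Lcat S) (dom s) := LHom d r.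
exists (cls (fmap F w x)).
  rewrite -(cls_incl h) /= Psi_funE Sets_fmapM; congr Some; apply: cls_arr => /=.
  have -> : t * ((s * t)^-1 * (s * t)) = (ran t : S) * (dom s : S) * t.
    by rewrite invsM /= !mulgA.
  by rewrite idemCE -mulgA ran_muls.
rewrite /= Psi_funE Sets_fmapM; congr Some; apply: cls_arr => /=.
by rewrite !mulgA mulsVs.
Qed.

Lemma Psi_act_idem (e : idem S) (x : F e) : Psi_act e (cls x).
Proof.
have h : e <= dom e by rewrite dom_idem; apply: nle_refl.
by rewrite -(cls_incl h) /= Psi_funE.
Qed.

Lemma Psi_act_idemP (e : idem S) a : Psi_act e a -> exists x : F e, a = cls x.
Proof.
case E: (Psi_act e a) => [b|] // _; move/Psi_funP: E => [x -> _].
have h : dom e <= e by rewrite dom_idem; apply: nle_refl.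
by exists (fmap F (Lincl h : hom (dom e : Lcat S) e) x); rewrite cls_incl.
Qed.

Lemma Psi_effective a : exists s, isSome (Psi_act s a).
Proof. by have [e [x ->]] := cls_surj a; exists e; apply: Psi_act_idem. Qed.

Definition Psi_set : nsset S := NSSet Psi_prehom Psi_effective.

Lemma Psi_connected : connected Psi_set.
Proof.
have H (p q : elements F) : clos_refl_sym_trans_1n _ (@elt_step _ F) p q ->
    forall a, a = cls (tagged p) ->
    exists s : seq (idem S),
    [/\ all (fun g : idem S => Psi_act g a) (tag p :: s),
        path (fun g h : idem S => `[< h <= g \/ g <= h >]) (tag p) s
      & last (tag p) s = tag q].
  elim=> {p q} [p|p q r pq _ IH] a ax.
    by exists [::]; split=> //; rewrite all_seq1 ax; apply: Psi_act_idem.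
  have cpq : cls (tagged p) = cls (tagged q).
    by case: pq => -[h ->]; rewrite cls_incl.
  have [s [s1 s2 s3]] := IH a (etrans ax cpq).
  exists (tag q :: s); split=> //.
    by rewrite -cat1s all_cat s1 all_seq1 ax Psi_act_idem.
  rewrite /= s2 andbT; apply/asboolP.
  by case: pq => -[h _]; [right|left].
move=> a e f /Psi_act_idemP[x ax] /Psi_act_idemP[y ay].
have /clsP/clos_rst_rst1n_iff xy : cls x = cls y by rewrite -ax -ay.
exact: H xy a ax.
Qed.

End PsiObject.

Section Psi.
Variable S : invSemigroupType.
Implicit Types F G H : functor (Lcat S) Sets.

Definition Psi_map F G (u : nattrans F G) (a : Psi_ob F) : Psi_ob G :=
  let p : elements F := repr a in cls (u (tag p) (tagged p)).

Lemma Psi_mapE F G (u : nattrans F G) (e : idem S) (x : F e) :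
  Psi_map u (cls x) = cls (u e x).
Proof.
have H (p q : elements F) : elt_equiv p q ->
    cls (u (tag p) (tagged p)) = cls (u (tag q) (tagged q)).
  elim=> {p q} [p q [h ->]|//|//|p q r _ -> _ ->] //.
  by rewrite Sets_naturality cls_incl.
have /eqmodP/asboolP h : \pi_{eq_quot @elt_rel S F} (repr (cls x)) = cls x.
  exact: reprK.
exact: H h.
Qed.

Lemma Psi_map_mor F G (F_tf : torsion_free F) (G_tf : torsion_free G)
  (u : nattrans F G) s a b :
  act (Psi_set F_tf) s a = Some b ->
  act (Psi_set G_tf) s (Psi_map u a) = Some (Psi_map u b).
Proof.
move=> /Psi_funP[x -> ->]; rewrite !Psi_mapE /= Psi_funE //; congr (Some (cls _)).
by rewrite Sets_naturality.
Qed.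

Definition Psi_mor F G (F_tf : torsion_free F) (G_tf : torsion_free G)
  (u : nattrans F G) : nsmor (Psi_set F_tf) (Psi_set G_tf) :=
  @NSMor _ (Psi_set F_tf) (Psi_set G_tf) (Psi_map u) (@Psi_map_mor F G F_tf G_tf u).

Lemma Psi_map1 F : Psi_map (idnat F) =1 id.
Proof. by move=> a; have [e [x ->]] := cls_surj a; rewrite Psi_mapE. Qed.

Lemma Psi_mapM F G H (v : nattrans G H) (u : nattrans F G) :
  Psi_map (compnat v u) =1 Psi_map v \o Psi_map u.
Proof. by move=> a; have [e [x ->]] := cls_surj a; rewrite /= !Psi_mapE. Qed.

Definition Psi : functor (TF S) (ConRepr S).
Proof.
exists (fun A : TF S => exist _ (Psi_set (svalP A)) (@Psi_connected _ _ (svalP A)))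
  (fun (A B : TF S) u => Psi_mor (svalP A) (svalP B) u).
- by move=> A; apply: nsmor_eq => a; apply: Psi_map1.
- by move=> A B C v u; apply: nsmor_eq => a; apply: Psi_mapM.
Defined.

End Psi.

(* Main.v *)
From mathcomp Require Import all_boot generic_quotient.
From mathcomp Require Import boolp.
Require Import Defs.

(** Both composites are compared with the identity through the classes
    [e, x] of the colimit.

    For a non-strict S-set X, a class of Psi (Phi X) is represented by a pair
    (e, x) with e . x defined, and the identifications made in the colimit
    change e along the order of E(S) but never the point x.  Forgetting e
    therefore gives a map Psi (Phi X) -> X ([point], [pointE]); it is onto
    because X is effective.  Its fibre over x consists of the classes [e, x] for
    all e defined at x, and connectedness says exactly that these e are linked
    by a zigzag of comparable idempotents defined at x, i.e. that the fibre is
    a single class ([cls_connected]).  The resulting inverse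
    x |-> [e, x] is the unit.

    For a torsion-free F, the idempotent e acts on Psi F with domain the set of
    classes [e, x], so x |-> [e, x] maps F e onto Phi (Psi F) e; torsion-freeness
    says that it is injective.  It is natural because the arrow (f, s) of L(S)
    induces the action of s on classes ([Psi_act_arr]).  Its inverse is the
    counit. *)

Set Implicit Arguments.
Unset Strict Implicit.
Unset Printing Implicit Defensive.

Local Open Scope invsg_scope.

Section Unit.
Variable S : invSemigroupType.
Implicit Types X Y : nsset S.

Lemma Phi_arr_incl X (e f : idem S) (h : e <= f) (x : Phi_ob X e) :
  sval (Phi_arr (Lincl h) x) = sval x.
Proof. by have /= /act_idem := Phi_arrE (Lincl h) x. Qed.

Lemma cls_le X (e f : idem S) (x : Phi_fun X e) (y : Phi_fun X f) :
  e <= f -> sval x = sval y -> cls x = cls y.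
Proof.
move=> ef xy; rewrite -(cls_incl ef); congr cls.
by apply: Phi_ob_eq; rewrite /= -xy; apply: Phi_arr_incl.
Qed.

(** The zigzag supplied by connectedness is a chain of the steps that generate
    the equivalence relation of the colimit. *)
Lemma cls_connected X (e f : idem S) (x : Phi_fun X e) (y : Phi_fun X f) :
  connected X -> sval x = sval y -> cls x = cls y.
Proof.
case: x y => [x ex] [y fy] cX /= xy; subst y.
have [p [/= /andP[_ px] ep pf]] := cX x e f ex fy.
elim: p e ex px ep pf => [|g p IH] e ex /=.
  by move=> _ _ ef; subst f; apply: cls_le => //; apply: nle_refl.
move=> /andP[gx px] /andP[/asboolP eg gp] pf.
rewrite -(IH g gx px gp pf).
by case: eg => [ge|eg]; [apply/esym/cls_le|apply: cls_le].
Qed.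

Lemma elt_equiv_point X (p q : elements (Phi_fun X)) :
  elt_equiv p q -> sval (tagged p) = sval (tagged q).
Proof.
elim=> {p q} [p q [h ->]|//|//|p q r _ -> _ ->] //.
exact/esym/Phi_arr_incl.
Qed.

Definition point X (a : Psi_ob (Phi_fun X)) : X :=
  sval (tagged (repr a : elements (Phi_fun X))).

Lemma pointE X (e : idem S) (x : Phi_fun X e) : point (cls x) = sval x.
Proof.
have /eqmodP/asboolP h :
    \pi_{eq_quot @elt_rel S (Phi_fun X)}%qT (repr (cls x)) = cls x.
  exact: reprK.
exact: elt_equiv_point h.
Qed.

(** The action on Psi (Phi X) carries a proof of torsion-freeness inside its
    bijections; keeping that proof arbitrary makes the lemma apply to whichever
    proof the composite functor Psi Phi' contains. *)
Lemma point_mor X (tf : torsion_free (Phi_fun X)) s a b :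
  act (Psi_set tf) s a = Some b ->
  act X s (point a) = Some (point b).
Proof. by move=> /Psi_funP[x -> ->]; rewrite !pointE; exact: (Phi_arrE (Larrow s) x). Qed.

(** Effectiveness provides some s acting on x, hence the idempotent d(s). *)
Lemma idem_effective X (x : X) : exists e : idem S, act X e x.
Proof. by have [s sx] := act_effective x; exists (dom s); rewrite act_dom. Qed.

Definition unit_map X (x : X) : Psi_ob (Phi_fun X) :=
  let: exist e ex := cid (idem_effective x) in
  cls (exist _ x ex : Phi_fun X e).

(** For connected X the chosen e does not matter; this is what makes the unit
    equivariant and natural. *)
Lemma unit_mapE X (e : idem S) (x : Phi_fun X e) :
  connected X -> unit_map (sval x) = cls x.
Proof. by move=> cX; rewrite /unit_map; case: cid => f fx; apply: cls_connected. Qed.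

Lemma unit_mapK X : cancel (@unit_map X) (@point X).
Proof. by move=> x; rewrite /unit_map; case: cid => e ex; rewrite pointE. Qed.

Lemma pointK X : connected X -> cancel (@point X) (@unit_map X).
Proof.
by move=> cX a; have [e [x ->]] := cls_surj a; rewrite pointE unit_mapE.
Qed.

(** If s . x is defined then so is d(s) . x, and the action of s on the class
    [d(s), x] is computed by the arrow (r(s), s), which sends x to s . x. *)
Lemma unit_map_mor X (cX : connected X) (tf : torsion_free (Phi_fun X)) s x y :
  act X s x = Some y ->
  act (Psi_set tf) s (unit_map x) = Some (unit_map y).
Proof.
move=> sx; have dx : act X (dom s) x by rewrite act_dom sx.
pose x' : Phi_fun X (dom s) := exist _ x dx.
have -> : y = sval (fmap (Phi_fun X) (Larrow s) x').
  by apply: Some_inj; rewrite -sx; apply: (Phi_arrE (Larrow s) x').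
rewrite (unit_mapE x' cX) (unit_mapE (fmap (Phi_fun X) (Larrow s) x') cX).
exact: Psi_funE.
Qed.

Lemma unit_map_nat X Y (g : nsmor X Y) x :
  connected Y -> unit_map (g x) = Psi_map (Phi_mor g) (unit_map x).
Proof.
move=> cY; rewrite {2}/unit_map; case: cid => e ex.
by rewrite Psi_mapE -unit_mapE.
Qed.

Definition unit_component (A : ConRepr S) :
  hom A (compfunctor (Psi S) (Phi' S) A) :=
  NSMor (unit_map_mor (svalP A) (svalP (Phi' S A))).

Lemma unit_natural (A B : ConRepr S) (g : hom A B) :
  compc (unit_component B) g
  = compc (fmap (compfunctor (Psi S) (Phi' S)) g) (unit_component A).
Proof. by apply: nsmor_eq => x; apply: unit_map_nat; apply: svalP B. Qed.

Lemma unit_iso :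
  naturally_isomorphic (idfunctor (ConRepr S)) (compfunctor (Psi S) (Phi' S)).
Proof.
exists (@NatTrans _ _ (idfunctor (ConRepr S)) (compfunctor (Psi S) (Phi' S))
          unit_component unit_natural) => A.
exists (NSMor (@point_mor (sval A) (svalP (Phi' S A)))); split; apply: nsmor_eq => x.
- exact: unit_mapK.
- exact: pointK (svalP A) x.
Qed.

End Unit.

Section Counit.
Variable S : invSemigroupType.
Implicit Types F G : functor (Lcat S) Sets.

Lemma cls_inj F (e : idem S) : torsion_free F -> injective (@cls S F e).
Proof. by move=> F_tf x y /clsP /F_tf. Qed.

(** The action of s on classes is defined by the arrow (r(s), s) alone; the
    arrows (f, s) with a larger target f induce the same map on classes. *)
Lemma Psi_act_arr F (F_tf : torsion_free F) (e f : idem S) (u : Lhom e f)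
    (x : F e) :
  act (Psi_set F_tf) u (cls x)
  = Some (cls (fmap F (u : hom (e : Lcat S) f) x)).
Proof.
case: u => s ds rs; subst e.
by rewrite /= Psi_funE //; congr Some; apply: cls_arr.
Qed.

Section Component.
Variables (F : functor (Lcat S) Sets) (F_tf : torsion_free F).

Definition to_cls (e : idem S) (x : F e) : Phi_ob (Psi_set F_tf) e :=
  exist _ (cls x) (Psi_act_idem F_tf x).

Definition counit_map (e : idem S) (a : Phi_ob (Psi_set F_tf) e) : F e :=
  projT1 (cid (Psi_act_idemP (svalP a))).

Lemma cls_counit (e : idem S) (a : Phi_ob (Psi_set F_tf) e) :
  cls (counit_map a) = sval a.
Proof. by rewrite /counit_map; case: cid. Qed.

Lemma counit_mapK e : cancel (@counit_map e) (@to_cls e).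
Proof. by move=> a; apply/Phi_ob_eq/cls_counit. Qed.

Lemma to_clsK e : cancel (@to_cls e) (@counit_map e).
Proof. by move=> x; apply: (cls_inj F_tf); rewrite cls_counit. Qed.

Lemma to_cls_arr (e f : idem S) (u : Lhom e f) (x : F e) :
  to_cls (fmap F (u : hom (e : Lcat S) f) x) = Phi_arr u (to_cls x).
Proof.
apply: Phi_ob_eq; apply: Some_inj.
by rewrite -Phi_arrE [RHS]Psi_act_arr.
Qed.

Lemma counit_map_arr (a b : Lcat S) (u : hom a b) :
  compc (@counit_map b : hom (Phi_fun (Psi_set F_tf) b : Sets) (F b))
    (fmap (Phi_fun (Psi_set F_tf)) u)
  = compc (fmap F u) (@counit_map a).
Proof.
apply: funext => x /=; apply: (can_inj (@to_clsK b)).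
by rewrite counit_mapK to_cls_arr counit_mapK.
Qed.

Lemma to_cls_nat (a b : Lcat S) (u : hom a b) :
  compc (@to_cls b : hom (F b : Sets) (Phi_fun (Psi_set F_tf) b)) (fmap F u)
  = compc (fmap (Phi_fun (Psi_set F_tf)) u) (@to_cls a).
Proof. by apply: funext => x; apply: to_cls_arr. Qed.

End Component.

Definition counit_component (A : TF S) :
  hom (compfunctor (Phi' S) (Psi S) A) A :=
  NatTrans (counit_map_arr (svalP A)).

Lemma counit_natural (A B : TF S) (u : hom A B) :
  compc (counit_component B) (fmap (compfunctor (Phi' S) (Psi S)) u)
  = compc u (counit_component A).
Proof.
apply: nattrans_eq => e; apply: funext => a /=.
apply: (cls_inj (svalP B)); rewrite cls_counit /=.
by rewrite -cls_counit Psi_mapE.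
Qed.

Lemma counit_iso :
  naturally_isomorphic (compfunctor (Phi' S) (Psi S)) (idfunctor (TF S)).
Proof.
exists (@NatTrans _ _ (compfunctor (Phi' S) (Psi S)) (idfunctor (TF S))
          counit_component counit_natural) => A.
exists (NatTrans (to_cls_nat (svalP A))).
by split; apply: nattrans_eq => e; apply: funext => x;
  [apply: counit_mapK|apply: to_clsK].
Qed.

End Counit.

Theorem theorem10 (S : invSemigroupType) :
  equivalence_of_categories (Phi' S) (Psi S).
Proof. by split; [apply: unit_iso|apply: counit_iso]. Qed.
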